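(* Let $G=(V,E)$ be a finite connected graph and let $M$ be a Markov kernel on $V$ that is positive on $G$ (reversible or not), with invariant distribution $\rho$. Let $\overleftarrow{M}_{x,y}=\rho_y M_{y,x}/\rho_x$ for $x,y\in V$. Let $W=(W_i,i\ge 0)$ be a Markov chain with kernel $M$, and let $\tau_{|V|}$ be its cover time. Then there is a constant $C$, depending on $G$ and $M$ but not on $(t,r)$, such that for every rooted spanning tree $(t,r)$ of $G$, $$\mathbb{P}\left[\mathrm{FET}(W_0,\dots,W_{\tau_{|V|}})=(t,r)\,\middle|\,W_0=r\right]=\frac{C}{\rho_r}\prod_{e\in E(t,r)}\overleftarrow{M}_{e}.$$
   Context: $V$ is the vertex set and $E$ the set of undirected edges of $G$. A Markov kernel $M=(M_{a,b},\,a,b\in V)$ is called positive on $G$ if $M_{a,b}>0\iff\{a,b\}\in E$; since $G$ is connected, $M$ is then irreducible and has a unique invariant distribution $\rho=(\rho_v,v\in V)$. A path on $G$ is a sequence $w=(w_0,w_1,\dots)$ of vertices with $\{w_k,w_{k+1}\}\in E$ for all $k$. For $1\le k\le |V|$, $\tau_k(w)=\inf\{j:|\{w_0,\dots,w_j\}|=k\}$ is the first time $w$ has visited $k$ distinct vertices; $\tau_{|V|}$ is the cover time. A finite path $(w_0,\dots,w_m)$ is covering if it visits all vertices and $m=\tau_{|V|}(w)$. A rooted spanning tree $(t,r)$ of $G$ is a spanning tree $t$ with a distinguished vertex $r\in V$ (the root). It is regarded as a directed graph with edges directed toward the root: $E(t,r)$ is the set of directed edges $e=(e^-,e^+)$ with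 $e^+=p(e^-)$ the parent of $e^-$. For $e=(e^-,e^+)$, $\overleftarrow{M}_e$ means $\overleftarrow{M}_{e^-,e^+}$. For a covering path $w$, the first entrance tree $\mathrm{FET}(w)$ is the rooted spanning tree with root $w_0$ and with the $|V|-1$ directed edges $(w_{\tau_k},w_{\tau_k-1})$ for $2\le k\le |V|$ (the reversals of the edges used to enter each vertex other than $w_0$ for the first time). *)

(* Defs.v *)
From mathcomp Require Import all_boot all_order all_algebra.
From mathcomp Require Import all_classical all_reals all_analysis.

Set Implicit Arguments.
Unset Strict Implicit.
Unset Printing Implicit Defensive.

Import Order.TTheory GRing.Theory Num.Theory.
Local Open Scope ring_scope.

Section Graphs.
Variable V : finType.
Implicit Types (E t : {set {set V}}) (a b r x y : V).

(* An undirected edge {a, b} is the set [set a; b]; a singleton [set a] is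
   therefore a loop at a. *)
Definition is_graph E : Prop :=
  forall A, A \in E -> exists a b, A = [set a; b]%SET.

Definition adj E : rel V := fun a b => [set a; b]%SET \in E.

Definition graph_connected E : Prop := forall x y, connect (adj E) x y.

Definition acyclic E : Prop :=
  (forall x, ~~ adj E x x) /\
  (forall c : seq V, (2 < size c)%N -> ~ ucycle (adj E) c).

Definition spanning_tree E t : Prop :=
  [/\ t \subset E, graph_connected t & acyclic t].

(* y is the vertex that follows x on the simple path of t from x to r; for
   x = r there is no such y. *)
Definition is_parent t r x y : Prop :=
  exists s : seq V,
    [/\ path (adj t) x (y :: s), uniq (x :: y :: s) & last y s = r].

(* The directed edges E(t, r). *)
Definition arcs t r : {set V * V} :=
  [set a : V * V | `[< is_parent t r a.1 a.2 >]]%SET.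

(* The rooted tree (t, r), regarded as a directed graph together with its root. *)
Definition rooted_tree t r : {set V * V} * V := (arcs t r, r).

Definition visited (w : nat -> V) (j : nat) : {set V} :=
  [set w i | i : 'I_j.+1]%SET.

(* inf {j : |{w_0, ..., w_j}| = k}, where None stands for +oo. *)
Definition tau (w : nat -> V) (k : nat) : option nat :=
  match pselect (exists j, #|visited w j| == k) with
  | left h => Some (ex_minn h)
  | right _ => None
  end.

(* First entrance tree of (w_0, ..., w_m) with m = tau w #|V|; it is only
   meaningful if tau w #|V| is not None, and then it does not depend on the
   terms of w after w_m. *)
Definition FET (w : nat -> V) : {set V * V} * V :=
  ([set a : V * V |
     [exists k : 'I_#|V|.+1,
        (1 < k)%N && (if tau w k is Some j then a == (w j, w j.-1)
                      else false)]]%SET,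
   w 0%N).

End Graphs.

Section Kernels.
Variables (R : realType) (V : finType).
Implicit Types (M : V -> V -> R) (rho : V -> R).

Definition markov_kernel M : Prop :=
  (forall a b, 0 <= M a b) /\ (forall a, \sum_b M a b = 1).

Definition positive_on (E : {set {set V}}) M : Prop :=
  forall a b, 0 < M a b <-> [set a; b]%SET \in E.

Definition invariant_distribution M rho : Prop :=
  [/\ forall a, 0 <= rho a, \sum_a rho a = 1 &
      forall b, \sum_a rho a * M a b = rho b].

Definition reversal M rho : V -> V -> R :=
  fun x y => rho y * M y x / rho x.

End Kernels.

Section Chains.
Variables (R : realType) (V : finType).
Variables (d : measure_display) (Omega : measurableType d).
Variable P : probability Omega R.
Local Open Scope classical_set_scope.

(* P[A | B], to be used only when B has positive probability. *)
Definition cprob (A B : set Omega) : R := fine (P (A `&` B)) / fine (P B).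

(* The initial distribution is arbitrary. *)
Definition markov_chain (M : V -> V -> R) (W : nat -> Omega -> V) : Prop :=
  (forall n x, measurable [set omega | W n omega = x]) /\
  (forall (n : nat) (x : nat -> V) (y : V),
     let past := [set omega | forall i, (i <= n)%N -> W i omega = x i] in
     (0 < P past)%E ->
     cprob [set omega | W n.+1 omega = y] past = M (x n) y).

(* The event FET(W_0, ..., W_tau) = T, where tau is the cover time of W. *)
Definition FET_event (W : nat -> Omega -> V) (T : {set V * V} * V) :
    set Omega :=
  [set omega | tau (W^~ omega) #|V| <> None /\ FET (W^~ omega) = T].

End Chains.

(* Main.v *)
Require Import Defs.
From mathcomp Require Import all_boot all_order all_algebra.
From mathcomp Require Import all_classical all_reals all_analysis.
From mathcomp Require Import ring zify.

(** Write N for the time reversal [reversal M rho] and consider rooted trees as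
   pairs (p, r) of a parent function and a root.  If the first entrance tree of
   w_1, w_2, ... is (p, y), then the first entrance tree of x, w_1, w_2, ... is
   obtained by making x the root and y a child of x: this is [reroot p y x].
   Prepending a vertex chosen by the reversed kernel N therefore defines a
   Markov kernel on trees, [tree_kernel], which moves (p, y) to
   (reroot p y x, x) with probability N y x.  Let q (p, r) be the probability
   that the chain started from r has first entrance tree (p, r).  By the Markov
   property at time 1, rho_r q (p, r) is invariant under the tree kernel.  So is
   the weight of a tree, the product of N over its edges ([tree_weight]).  As
   every tree can be turned into every other one by successive rerootings along
   edges of the graph ([connect_reroot_tree]), the two are proportional.

   Three observations keep this short.  First, on a finite set a measure mu with
   mu K <= mu is invariant, because mu and mu K have the same mass
   ([subinvariant_stationary]).  For q this reduces the claim to walks whose tail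
   is already covering ([entrance_prob_step]); for the weights it reduces a
   bijection between the predecessors of a tree and the vertices of the graph to
   an injection ([reroot_inj]).  Second, comparing the two measures at the tree
   where their ratio is minimal ([stationary_proportional]) turns uniqueness into
   mere reachability.  Third, to reach a tree t with root r by rerootings, start
   from r and, for each vertex v, walk down t to v and back up: the way back
   makes all the vertices between v and r point to their parents in t, and
   nothing else has changed ([connect_reroot_excursion]).

   So that the constant depends on neither the probability space nor the initial
   distribution, q is defined as a limit of finite sums over paths
   ([entrance_law]); the link with an actual chain is [cprob_FET_event]. *)

Set Implicit Arguments.
Unset Strict Implicit.
Unset Printing Implicit Defensive.

Import Order.TTheory GRing.Theory Num.Theory.
Import numFieldNormedType.Exports.
Local Open Scope ring_scope.

(** * Invariant measures of a finite Markov kernel *)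

Section FiniteKernels.
Variables (R : realType) (S : finType) (K : S -> S -> R).
Implicit Types (mu om : S -> R) (s : S).

Definition stationary mu := forall s', \sum_s mu s * K s s' = mu s'.

(** Both sides of the inequality have the same total mass, since the rows of K
   sum to 1, so no term can be strict. *)
Lemma subinvariant_stationary mu :
  (forall s, \sum_s' K s s' = 1) ->
  (forall s', \sum_s mu s * K s s' <= mu s') -> stationary mu.
Proof.
move=> K1 le s'; apply/eqP; rewrite eq_sym -subr_eq0; apply/eqP.
have mass : \sum_s' (mu s' - \sum_s mu s * K s s') = 0.
  rewrite sumrB exchange_big /=; apply/eqP; rewrite subr_eq0; apply/eqP.
  by apply: eq_bigr => s _; rewrite -mulr_sumr K1 mulr1.
have ge0 i : true -> 0 <= mu i - \sum_s mu s * K s i by rewrite subr_ge0.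
exact: (psumr_eq0P ge0 mass).
Qed.

(** The mass of s' is a sum of nonnegative contributions of its predecessors,
   so it can vanish only if all of them do. *)
Lemma stationary_null_connect mu s s' :
  (forall s s', 0 <= K s s') -> (forall s, 0 <= mu s) -> stationary mu ->
  connect (fun s s' => 0 < K s s') s s' -> mu s' = 0 -> mu s = 0.
Proof.
move=> K0 mu0 inv /connectP[p]; elim: p s => [|a p IH] s /=.
  by move=> _ ->.
case/andP=> Ksa pth e null; have mua := IH a pth e null.
have sum0 : \sum_s mu s * K s a = 0 by rewrite inv.
have ge0 i : true -> 0 <= mu i * K i a by rewrite mulr_ge0.
move/eqP: (psumr_eq0P ge0 sum0 (i := s) isT).
by rewrite mulf_eq0 (gt_eqF Ksa) orbF => /eqP.
Qed.

(** Subtract from mu the largest multiple of om that stays below it: the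
   difference is invariant, nonnegative, and vanishes at a minimum of the ratio,
   hence at every state from which this minimum is reached. *)
Lemma stationary_proportional mu om :
  (forall s s', 0 <= K s s') -> (forall s, 0 <= mu s) ->
  (forall s, 0 <= om s) -> stationary mu -> stationary om ->
  (forall s s', 0 < om s -> 0 < om s' ->
     connect (fun s s' => 0 < K s s') s s') ->
  exists C, forall s, 0 < om s -> mu s = C * om s.
Proof.
move=> K0 mu0 om0 muK omK irr.
case: (pickP [pred s | 0 < om s]) => [s1 /= os1|none]; last first.
  by exists 0 => s os; move: (none s); rewrite /= os.
case: (arg_minP (P := [pred s | 0 < om s]) (fun s => mu s / om s) os1).
move=> s0 /= os0 min0; exists (mu s0 / om s0) => s os.
pose u s := mu s - mu s0 / om s0 * om s.
have u0 : u s0 = 0 by rewrite /u divfK ?subrr // gt_eqF.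
suff : u s = 0 by move/eqP; rewrite subr_eq0 => /eqP.
apply: (@stationary_null_connect u s s0) => // [s'|s'|]; last exact: irr.
  rewrite subr_ge0; have [os'|] := ltP 0 (om s').
    by rewrite -ler_pdivlMr // min0.
  by move=> /(conj (om0 s'))/andP/le_anti <-; rewrite mulr0.
rewrite /u -[mu s' in RHS]muK -[om s' in RHS]omK mulr_sumr -sumrB.
by apply: eq_bigr => i _; rewrite mulrBl mulrA.
Qed.

End FiniteKernels.

(** * Rooted trees as parent functions *)

Section ParentFunctions.
Variable V : finType.
Implicit Types (p : {ffun V -> V}) (r v x y : V).

(** The root is encoded as a fixed point of the parent function. *)
Definition ptree p r := (p r == r) && [forall v, fconnect p v r].

(** If p has root y, adds the arc from y to x and removes the arc leaving x,
   which becomes the root. *)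
Definition reroot p y x : {ffun V -> V} :=
  [ffun v => if (v == x) || (v == y) then x else p v].

Lemma reroot_id p x : p x = x -> reroot p x x = p.
Proof.
by move=> px; apply/ffunP => v; rewrite ffunE orbb; case: eqP => // ->.
Qed.

Lemma ptreeP p r : reflect (p r = r /\ forall v, exists k, iter k p v = r)
  (ptree p r).
Proof.
apply: (iffP andP) => -[].
  move=> /eqP pr /forallP conn; split=> // v.
  by exists (findex p v r); rewrite iter_findex.
move=> pr it; split; first exact/eqP.
by apply/forallP => v; have [k <-] := it v; apply: fconnect_iter.
Qed.

Lemma iter_fix_eq (f : V -> V) k r : f r = r -> iter k f r = r.
Proof. by move=> fr; elim: k => //= k ->. Qed.

Lemma ptree_fix p r x : ptree p r -> p x = x -> x = r.
Proof. by case/ptreeP=> _ /(_ x)[k <-] /(iter_fix_eq k) ->. Qed.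

(** The path of p from v to y leads to x in the new function as soon as it meets
   x or y, the only vertices whose parent has changed. *)
Lemma reroot_ptree p y x : ptree p y -> ptree (reroot p y x) x.
Proof.
case/ptreeP=> py it; apply/ptreeP; split=> [|v]; first by rewrite ffunE eqxx.
have [k] := it v; elim: k v => [|k IH] v.
  by move=> /= ->; exists 1%N; rewrite /= ffunE eqxx orbT.
rewrite iterSr => /IH[m im].
have [vx|nvx] := eqVneq v x; first by exists 0%N.
have [vy|nvy] := eqVneq v y; first by exists 1%N; rewrite /= ffunE vy eqxx orbT.
by exists m.+1; rewrite iterSr ffunE (negbTE nvx) (negbTE nvy).
Qed.

(** The orbit of x is a cycle here, and f is injective on it. *)
Lemma uniq_preimage_cycle (f : V -> V) x y1 y2 :
  fconnect f x y1 -> fconnect f x y2 -> f y1 = x -> f y2 = x -> y1 = y2.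
Proof.
have idx y : fconnect f x y -> f y = x -> (findex f x y).+1 = order f x.
  move=> xy fy; have lt := findex_max xy.
  apply/eqP; rewrite eqn_leq lt /= leqNgt; apply/negP => lt2.
  have := findex_iter lt2; rewrite iterS iter_findex // fy findex0.
  by [].
move=> xy1 xy2 /(idx _ xy1) e1 /(idx _ xy2) e2.
by rewrite -(iter_findex xy1) -(iter_findex xy2); congr iter; apply: succn_inj;
  rewrite e1 e2.
Qed.

(** A tree is determined by the result of rerooting it at x together with the
   former parent of x.  Let f be the new parent function, except that x keeps its
   former parent: then f agrees with each p_i outside y_i, so that f leads from x
   to y_i and then back to x.  Thus y_1 and y_2 are both the predecessor of x on
   the cycle of f through x. *)
Lemma reroot_inj p1 y1 p2 y2 x :
  ptree p1 y1 -> ptree p2 y2 -> reroot p1 y1 x = reroot p2 y2 x ->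
  p1 x = p2 x -> (p1, y1) = (p2, y2).
Proof.
move=> t1 t2 e ex.
have [[py1 it1] [py2 it2]] := (ptreeP _ _ t1, ptreeP _ _ t2).
suff ey : y1 = y2.
  subst y2; congr pair; apply/ffunP => v.
  have [->|nvy] := eqVneq v y1; first by rewrite py1 py2.
  have [->//|nvx] := eqVneq v x.
  by move/ffunP/(_ v): e; rewrite !ffunE (negbTE nvx) (negbTE nvy).
have [xy1|nxy1] := eqVneq x y1.
  by rewrite -xy1; apply: ptree_fix t2 _; rewrite -ex xy1.
have [xy2|nxy2] := eqVneq x y2.
  by rewrite -xy2; apply/esym; apply: ptree_fix t1 _; rewrite ex xy2.
pose f v := if v == x then p1 x else reroot p1 y1 x v.
have fy p y : reroot p y x = reroot p1 y1 x -> x != y -> f y = x.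
  by move=> ep nxy; rewrite /f eq_sym (negbTE nxy) -ep ffunE eqxx orbT.
have reach p y : reroot p y x = reroot p1 y1 x -> p x = p1 x ->
    (exists k, iter k p x = y) -> fconnect f x y.
  move=> ep epx [k]; move: {1 2}x; elim: k => [|k IH] a; first by move=> /= ->.
  rewrite iterSr => /IH pay.
  have [->//|nay] := eqVneq a y.
  apply: connect_trans pay; rewrite (_ : p a = f a) ?fconnect1 // /f.
  by case: eqP => [->//|/eqP nax]; rewrite -ep ffunE (negbTE nax) (negbTE nay).
exact: (uniq_preimage_cycle (reach p1 y1 erefl erefl (it1 x))
  (reach p2 y2 (esym e) (esym ex) (it2 x)) (fy p1 y1 erefl nxy1)
  (fy p2 y2 (esym e) nxy2)).
Qed.

End ParentFunctions.

(** * Reaching a tree by rerootings *)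

Section RerootConnect.
Variables (V : finType) (e : rel V).
Hypothesis e_sym : symmetric e.
Implicit Types (p : {ffun V -> V}) (r v x y : V).

Definition reroot_rel : rel ({ffun V -> V} * V) :=
  fun T T' => e T.2 T'.2 && (T'.1 == reroot T.1 T.2 T'.2).

Lemma connect_reroot1 p y x : e y x ->
  connect reroot_rel (p, y) (reroot p y x, x).
Proof. by move=> eyx; apply: connect1; rewrite /reroot_rel /= eyx eqxx. Qed.

Lemma connect_reroot_root p x y : connect e x y -> p x = x ->
  exists2 p', connect reroot_rel (p, x) (p', y) & p' y = y.
Proof.
move=> /connectP[s]; elim: s p x => [|z s IH] p x /=.
  by move=> _ -> px; exists p.
case/andP=> exz pth lst px.
have [|p' cp p'y] := IH (reroot p x z) z pth lst; first by rewrite ffunE eqxx.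
by exists p' => //; apply: connect_trans cp; apply: connect_reroot1.
Qed.

(* q is the target tree, and r its root. *)
Variables (q : {ffun V -> V}) (r : V).
Hypothesis q_root : q r = r.
Hypothesis q_edge : forall v, v != r -> e v (q v).

(** Walking from r down to v changes the parents of the vertices met on the way
   only, which all lie between v and r in q. *)
Lemma connect_reroot_descend k v p : iter k q v = r -> p r = r ->
  exists p', [/\ connect reroot_rel (p, r) (p', v), p' v = v &
    forall u, p u = q u -> p' u = q u \/ fconnect q v u].
Proof.
elim: k v => [|k IH] v; first by move=> /= -> pr; exists p; split=> // u; left.
rewrite iterSr => it pr; have [p1 [c1 fix1 keep]] := IH _ it pr.
have [vr|nvr] := eqVneq v r.
  by exists p; rewrite vr; split=> // u; left.
exists (reroot p1 (q v) v); split; last 2 first.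
- by rewrite ffunE eqxx.
- move=> u /keep[pu|]; last first.
    by move=> cu; right; apply: connect_trans cu; apply: fconnect1.
  rewrite ffunE; case: eqP => [->|_] /=; first by right.
  by case: eqP => [->|_]; [right; apply: fconnect1|left].
apply: connect_trans c1 _; apply: connect_reroot1.
by rewrite e_sym q_edge.
Qed.

(** On the way up each vertex is left for its parent in q, and this remains its
   parent since it is not visited again. *)
Lemma connect_reroot_ascend k v p : iter k q v = r -> p v = v ->
  exists p', [/\ connect reroot_rel (p, v) (p', r), p' r = r &
    forall u, p u = q u \/ fconnect q v u -> p' u = q u].
Proof.
elim: k v p => [|k IH] v p.
  move=> /= -> pr; exists p; split=> // u [//|cu].
  by rewrite -(iter_findex cu) (iter_fix_eq _ q_root) pr.
rewrite iterSr => it pv; have [vr|nvr] := eqVneq v r.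
  rewrite vr in pv *; exists p; split=> // u [//|cu].
  by rewrite -(iter_findex cu) (iter_fix_eq _ q_root) pv.
have fixq : reroot p v (q v) (q v) = q v by rewrite ffunE eqxx.
have [p' [c' fix' agree]] := IH _ _ it fixq; exists p'; split=> // [|u hu].
  by apply: connect_trans c'; apply/connect_reroot1/q_edge.
apply: agree; rewrite ffunE; have [->|nuq] /= := eqVneq u (q v); first by right.
have [->|nuv] := eqVneq u v; first by left.
case: hu => [|cu]; [by left|right].
have := iter_findex cu; case: (findex q v u) => [/= vu|m].
  by rewrite vu eqxx in nuv.
by rewrite iterSr => <-; apply: fconnect_iter.
Qed.

(** What the descent to v may have spoilt lies between v and r, and is repaired
   by the ascent. *)
Lemma connect_reroot_excursion k v p : iter k q v = r -> p r = r ->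
  exists p', [/\ connect reroot_rel (p, r) (p', r), p' r = r, p' v = q v &
    forall u, p u = q u -> p' u = q u].
Proof.
move=> it pr; have [p1 [c1 fix1 keep1]] := connect_reroot_descend it pr.
have [p2 [c2 fix2 keep2]] := connect_reroot_ascend it fix1.
exists p2; split=> //; first exact: connect_trans c1 c2.
  by apply: keep2; right; apply: connect0.
by move=> u /keep1; apply: keep2.
Qed.

(** One excursion per vertex makes all the parents agree with q. *)
Lemma connect_reroot_tree p y : (forall x y, connect e x y) ->
  (forall v, exists k, iter k q v = r) -> p y = y ->
  connect reroot_rel (p, y) (q, r).
Proof.
move=> conn it py; have [p1 c1 p1r] := connect_reroot_root (conn y r) py.
suff fix_on (s : seq V) : exists p2, [/\ connect reroot_rel (p1, r) (p2, r),
    p2 r = r & {in s, p2 =1 q}].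
  have [p2 [c2 _ p2q]] := fix_on (enum V); apply: connect_trans c1 _.
  by rewrite (_ : q = p2) //; apply/ffunP => v; rewrite p2q // mem_enum.
elim: s => [|v s [p2 [c2 p2r p2q]]]; first by exists p1.
have [k itv] := it v.
have [p3 [c3 p3r p3v keep]] := connect_reroot_excursion itv p2r.
exists p3; split=> // [|u]; first exact: connect_trans c2 c3.
by rewrite inE => /orP[/eqP ->|/p2q /keep].
Qed.

End RerootConnect.

(** * The Markov chain on rooted trees *)

Section TreeKernel.
Variables (R : realType) (V : finType) (N : V -> V -> R).
Hypothesis N_ge0 : forall x y, 0 <= N x y.
Hypothesis N_sum1 : forall x, \sum_y N x y = 1.

Local Notation tree_state := ({ffun V -> V} * V)%type.
Implicit Types (T : tree_state).

Definition tree_kernel T T' : R :=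
  N T.2 T'.2 * (reroot T.1 T.2 T'.2 == T'.1)%:R.

Definition tree_weight T : R :=
  if ptree T.1 T.2 then \prod_(v | v != T.2) N v (T.1 v) else 0.

Lemma tree_kernel_ge0 T T' : 0 <= tree_kernel T T'.
Proof. exact: mulr_ge0. Qed.

Lemma tree_weight_ge0 T : 0 <= tree_weight T.
Proof. by rewrite /tree_weight; case: ifP => // _; apply: prodr_ge0. Qed.

Lemma tree_kernel_sum1 T : \sum_T' tree_kernel T T' = 1.
Proof.
rewrite -(N_sum1 T.2).
rewrite -(pair_big xpredT xpredT (fun p x => tree_kernel T (p, x))) /=.
rewrite exchange_big; apply: eq_bigr => x _.
rewrite (bigD1 (reroot T.1 T.2 x)) //= big1 ?addr0 => [|p neq].
  by rewrite /tree_kernel /= eqxx mulr1.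
by rewrite /tree_kernel /= eq_sym (negbTE neq) mulr0.
Qed.

(** The two trees differ only by the arcs leaving x and y: the first has one from
   x to p x, the second one from y to x, and the other factors supply the missing
   arc on each side. *)
Lemma tree_weight_reroot p y x : ptree p y ->
  tree_weight (p, y) * N y x = tree_weight (reroot p y x, x) * N x (p x).
Proof.
move=> tp; rewrite /tree_weight /= tp reroot_ptree //.
have [py _] := ptreeP _ _ tp.
have [<-|nyx] := eqVneq y x; first by rewrite reroot_id // py.
rewrite (bigD1 x) 1?eq_sym //= [in RHS](bigD1 y) //= ffunE eqxx orbT.
rewrite (eq_bigl (fun v => (v != x) && (v != y))) => [|v]; last exact: andbC.
rewrite [in RHS](eq_bigr (fun v => N v (p v))) => [|v /andP[nvx nvy]].
  by rewrite mulrC [X in _ * X = _]mulrC mulrA.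
by rewrite ffunE (negbTE nvx) (negbTE nvy).
Qed.

(** By [tree_weight_reroot], a predecessor (p, y) of the tree (p', x) contributes
   the weight of (p', x) times N x (p x); as (p, y) is determined by p x, these
   factors add up to at most a row sum of N. *)
Lemma tree_weight_subinvariant T' :
  \sum_T tree_weight T * tree_kernel T T' <= tree_weight T'.
Proof.
case: T' => p' x.
pose D := [set T : tree_state | ptree T.1 T.2 & reroot T.1 T.2 x == p']%SET.
(* Only trees have a positive weight, hence only those in D contribute. *)
rewrite (bigID (mem D)) /= [X in _ + X]big1 ?addr0; last first.
  move=> [p y]; rewrite inE /tree_kernel /tree_weight /=.
  by case: ifP => _ /=; [move/negbTE ->; rewrite mulr0 mulr0|rewrite mul0r].
have injD : {in D &, injective (fun T : tree_state => T.1 x)}.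
  move=> [p1 y1] [p2 y2]; rewrite !inE /=.
  move=> /andP[t1 /eqP e1] /andP[t2 /eqP e2].
  by apply: reroot_inj => //; rewrite e1 e2.
rewrite (eq_bigr (fun T => tree_weight (p', x) * N x (T.1 x))); last first.
  move=> [p y]; rewrite inE /= => /andP[tp /eqP <-].
  by rewrite /tree_kernel /= eqxx mulr1 tree_weight_reroot.
rewrite -mulr_sumr ler_piMr ?tree_weight_ge0 //.
rewrite -(big_imset (fun z => N x z) injD) /= -(N_sum1 x).
rewrite [leRHS](bigID (mem [set T.1 x | T : tree_state in D]%SET)) /=.
by rewrite lerDl sumr_ge0.
Qed.

Lemma tree_weight_connect T T' :
  (forall x y, (0 < N x y) = (0 < N y x)) ->
  (forall x y, connect (fun x y => 0 < N x y) x y) ->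
  0 < tree_weight T -> 0 < tree_weight T' ->
  connect (fun T T' => 0 < tree_kernel T T') T T'.
Proof.
move: T T' => [p y] [q r] N_sym conn.
rewrite /tree_weight /=; case: ifP => [/ptreeP[py _] _|]; last by rewrite ltxx.
case: ifP => [/ptreeP[qr it] wq|]; last by rewrite ltxx.
have q_edge v : v != r -> 0 < N v (q v).
  move=> nvr; rewrite lt_def N_ge0 andbT; apply: contraTneq wq => N0.
  by rewrite (bigD1 v) //= N0 mul0r ltxx.
have sub : subrel (reroot_rel (fun x y => 0 < N x y))
    (fun T T' => 0 < tree_kernel T T').
  move=> [p1 y1] [p2 y2] /andP[/= pos /eqP ->].
  by rewrite /tree_kernel /= eqxx mulr1.
apply: (connect_sub (fun T T' h => connect1 (sub T T' h))).
exact: connect_reroot_tree.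
Qed.

Lemma tree_weight_unique (mu : tree_state -> R) :
  (forall x y, (0 < N x y) = (0 < N y x)) ->
  (forall x y, connect (fun x y => 0 < N x y) x y) ->
  (forall T, 0 <= mu T) ->
  (forall T', \sum_T mu T * tree_kernel T T' <= mu T') ->
  exists C, forall T, 0 < tree_weight T -> mu T = C * tree_weight T.
Proof.
move=> N_sym conn mu_ge0 mu_sub.
apply: (stationary_proportional tree_kernel_ge0 mu_ge0 tree_weight_ge0).
- exact: subinvariant_stationary tree_kernel_sum1 mu_sub.
- exact: subinvariant_stationary tree_kernel_sum1 tree_weight_subinvariant.
- by move=> T T'; apply: tree_weight_connect.
Qed.

End TreeKernel.

(** * First entrances of a finite path *)

Section FirstEntrance.
Variable V : finType.
Implicit Types (p : {ffun V -> V}) (s : seq V) (x y z : V).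

Definition covers y s := [forall v, v \in y :: s].

(** The index of y itself is 0, and so is its predecessor: the root gets itself
   as its parent. *)
Definition entrance y s : {ffun V -> V} :=
  [ffun v => nth y (y :: s) (index v (y :: s)).-1].

Definition covers_with p y s := covers y s && (entrance y s == p).

(** A vertex other than x is entered at the same moment with or without the
   initial x, and from the same vertex, except for y, which is now entered
   from x. *)
Lemma entrance_cons x y s :
  covers y s -> entrance x (y :: s) = reroot (entrance y s) y x.
Proof.
move=> /forallP cov; apply/ffunP => v; rewrite !ffunE.
have [->|nvx] /= := eqVneq v x; first by rewrite eqxx.
rewrite eq_sym (negbTE nvx) /= [v == y]eq_sym; have [//|nvy] := eqVneq y v.
have := cov v; rewrite inE eq_sym (negbTE nvy) /= -index_mem.
case: (index v s) => //= m /ltnW ltm.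
exact: set_nth_default.
Qed.

Lemma covers_with_rcons p y s z :
  covers_with p y s -> covers_with p y (rcons s z).
Proof.
move=> /andP[/forallP cov /eqP <-]; apply/andP; split.
  by apply/forallP => v; rewrite -rcons_cons mem_rcons inE cov orbT.
apply/eqP/ffunP => v; rewrite !ffunE -rcons_cons -cats1 index_cat cov.
rewrite nth_cat (leq_ltn_trans (leq_pred _)) // index_mem.
exact: cov.
Qed.

End FirstEntrance.

(** * Sums over paths and the law of the first entrance tree *)

Section PathSums.
Variables (R : realType) (V : finType) (M : V -> V -> R).
Hypothesis M_kernel : markov_kernel M.
Implicit Types (f g : seq V -> R) (y z : V) (n : nat).

(** The expectation of f (W_1, ..., W_n) for the chain W with kernel M started
   from y. *)
Fixpoint path_sum n y f : R :=
  if n is m.+1 then \sum_z M y z * path_sum m z (fun s => f (z :: s))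
  else f [::].

Lemma path_sumS n y f :
  path_sum n.+1 y f = \sum_z M y z * path_sum n z (fun s => f (z :: s)).
Proof. by []. Qed.

Lemma le_path_sum n y f g : (forall s, f s <= g s) ->
  path_sum n y f <= path_sum n y g.
Proof.
have [M0 _] := M_kernel.
elim: n y f g => [|n IH] y f g fg //=.
by apply: ler_sum => z _; apply: ler_wpM2l => //; apply: IH => s.
Qed.

Lemma path_sum_cst n y (c : R) : path_sum n y (fun=> c) = c.
Proof.
have [_ M1] := M_kernel; elim: n y => //= n IH y.
by under eq_bigr do rewrite IH; rewrite -mulr_suml M1 mul1r.
Qed.

Lemma path_sum_lin (I : finType) (a : I -> R) (f : I -> seq V -> R) n y :
  path_sum n y (fun s => \sum_i a i * f i s) = \sum_i a i * path_sum n y (f i).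
Proof.
elim: n y f => //= n IH y f.
under eq_bigr do rewrite IH mulr_sumr.
rewrite exchange_big; apply: eq_bigr => i _; rewrite mulr_sumr.
by apply: eq_bigr => z _; rewrite mulrCA.
Qed.

(** The last step averages values of f that are at least the one without it. *)
Lemma path_sum_leS n y f : (forall s z, f s <= f (rcons s z)) ->
  path_sum n y f <= path_sum n.+1 y f.
Proof.
have [M0 M1] := M_kernel.
elim: n y f => [|n IH] y f fle.
  rewrite /= -[leLHS]mul1r -(M1 y) mulr_suml.
  by apply: ler_sum => z _; apply: ler_wpM2l; [|exact: (fle [::] z)].
rewrite [leLHS]path_sumS [leRHS]path_sumS; apply: ler_sum => z _.
by apply: ler_wpM2l => //; apply: IH => s a; rewrite -rcons_cons.
Qed.

End PathSums.

Section EntranceLaw.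
Variables (R : realType) (V : finType) (M : V -> V -> R).
Hypothesis M_kernel : markov_kernel M.
Implicit Types (p : {ffun V -> V}) (r x y : V) (n : nat).

(** The probability that the chain started from r has covered V by time n, with
   first entrances given by p. *)
Definition entrance_prob p r n : R :=
  path_sum M n r (fun s => (covers_with p r s)%:R).

Definition entrance_law p r : R := limn (entrance_prob p r).

Lemma entrance_prob_ge0 p r n : 0 <= entrance_prob p r n.
Proof. by rewrite -{1}(path_sum_cst M_kernel n r 0) le_path_sum. Qed.

Lemma entrance_prob_nd p r : nondecreasing_seq (entrance_prob p r).
Proof.
apply/nondecreasing_seqP => n; apply: path_sum_leS => // s z.
rewrite ler_nat; case: (boolP (covers_with p r s)) => // h.
by rewrite covers_with_rcons.
Qed.

Lemma entrance_prob_cvg p r :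
  (entrance_prob p r n @[n --> \oo] --> entrance_law p r)%classic.
Proof.
apply: nondecreasing_is_cvgn; first exact: entrance_prob_nd.
exists 1 => _ [n _ <-]; rewrite -(path_sum_cst M_kernel n r 1).
by apply: le_path_sum => // s; rewrite lern1 leq_b1.
Qed.

Lemma entrance_prob_le_law p r n : entrance_prob p r n <= entrance_law p r.
Proof.
apply: nondecreasing_cvgn_le; first exact: entrance_prob_nd.
by apply: (cvgP (entrance_law p r)); apply: entrance_prob_cvg.
Qed.

Lemma entrance_law_ge0 p r : 0 <= entrance_law p r.
Proof.
exact: le_trans (entrance_prob_ge0 p r 0) (entrance_prob_le_law _ _ _).
Qed.

(** Conditioning on the first step.  There is only an inequality, because the
   walk may cover V while its tail, which need not return to x, does not. *)
Lemma entrance_prob_step p' x n :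
  \sum_y M x y * (\sum_p (reroot p y x == p')%:R * entrance_prob p y n)
    <= entrance_prob p' x n.+1.
Proof.
have [M0 _] := M_kernel.
apply: ler_sum => y _; apply: ler_wpM2l => //.
rewrite -path_sum_lin; apply: le_path_sum => // s.
have [cov|ncov] := boolP (covers y s); last first.
  by rewrite big1 // => p _; rewrite /covers_with (negbTE ncov) mulr0.
rewrite (bigD1 (entrance y s)) //= [X in _ + X]big1 ?addr0 => [|p neq].
  rewrite /covers_with cov eqxx mulr1 entrance_cons //.
  rewrite (_ : covers x (y :: s)) //.
  by apply/forallP => v; rewrite inE (forallP cov) orbT.
by rewrite /covers_with [_ == p]eq_sym (negbTE neq) andbF mulr0.
Qed.

Lemma entrance_law_step p' x :
  \sum_y M x y * (\sum_p (reroot p y x == p')%:R * entrance_law p y)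
    <= entrance_law p' x.
Proof.
pose u n := \sum_y M x y *
  (\sum_p (reroot p y x == p')%:R * entrance_prob p y n).
have u_cvg : (u n @[n --> \oo] --> \sum_y M x y *
    (\sum_p (reroot p y x == p')%:R * entrance_law p y))%classic.
  apply: (cvg_big add_continuous) => y _; apply: cvgMl_tmp.
  apply: (cvg_big add_continuous) => p _; apply: cvgMl_tmp.
  exact: entrance_prob_cvg.
rewrite -(cvg_lim _ u_cvg) //; apply: limr_le; first exact: (cvgP _ u_cvg).
apply: nearW => n; apply: le_trans (entrance_prob_step _ _ _) _.
exact: entrance_prob_le_law.
Qed.

End EntranceLaw.

(** * Proportionality to the tree weights *)

Section Proportionality.
Variables (R : realType) (V : finType) (E : {set {set V}}).
Variables (M : V -> V -> R) (rho : V -> R).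
Hypothesis connE : graph_connected E.
Hypothesis M_kernel : markov_kernel M.
Hypothesis posM : positive_on E M.
Hypothesis rho_inv : invariant_distribution M rho.
Implicit Types x y : V.

(** Positivity spreads along the edges, from some vertex of positive mass. *)
Lemma invariant_gt0 x : 0 < rho x.
Proof.
have [rho0 rho1 rhoM] := rho_inv; have [M0 _] := M_kernel.
have [a rhoa] : exists a, 0 < rho a.
  apply/existsP; apply: contraT; rewrite negb_exists => /forallP all0.
  move/eqP: rho1; rewrite big1 ?(eq_sym 0) ?oner_eq0 // => a _.
  by apply: le_anti; rewrite rho0 andbT leNgt all0.
have /connectP[s] := connE a x; elim: s a rhoa => [|b s IH] a rhoa /=.
  by move=> _ ->.
case/andP=> /posM Mab; apply: IH.
rewrite -rhoM (bigD1 a) //= ltr_wpDr ?mulr_gt0 //.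
by apply: sumr_ge0 => c _; apply: mulr_ge0.
Qed.

Lemma reversal_gt0 x y : (0 < reversal M rho x y) = ([set x; y]%SET \in E).
Proof.
rewrite /reversal pmulr_lgt0 ?invr_gt0 ?invariant_gt0 //.
rewrite pmulr_rgt0 ?invariant_gt0 // finset.setUC.
by apply/idP/idP => /posM.
Qed.

Lemma reversal_ge0 x y : 0 <= reversal M rho x y.
Proof.
have [M0 _] := M_kernel.
by rewrite !mulr_ge0 ?invr_ge0 // ltW ?invariant_gt0.
Qed.

Lemma reversal_sum1 x : \sum_y reversal M rho x y = 1.
Proof.
have [_ _ rhoM] := rho_inv.
by rewrite -mulr_suml rhoM divff // gt_eqF ?invariant_gt0.
Qed.

(** The tree kernel prepends a vertex x to a walk started from y with the reversed
   probability, and rho y times the latter is rho x * M x y, the stationary mass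
   of the step from x to y: hence [entrance_law_step] says that rho r times the
   law of the first entrance tree is subinvariant. *)
Lemma entrance_law_proportional : exists C, forall (p : {ffun V -> V}) r,
  ptree p r -> (forall v, v != r -> [set v; p v]%SET \in E) ->
  entrance_law M p r = C / rho r * \prod_(v | v != r) reversal M rho v (p v).
Proof.
pose mu (T : {ffun V -> V} * V) := rho T.2 * entrance_law M T.1 T.2.
have [|||| C propC] := @tree_weight_unique R V (reversal M rho)
  reversal_ge0 reversal_sum1 mu.
- by move=> x y; rewrite !reversal_gt0 finset.setUC.
- move=> x y; rewrite (eq_connect (e' := adj E)) // => a b.
  exact: reversal_gt0.
- by move=> T; rewrite mulr_ge0 ?entrance_law_ge0 // ltW ?invariant_gt0.
- move=> [p' x]; apply: le_trans (ler_wpM2l _ (entrance_law_step M_kernel p' x));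
    last by rewrite ltW ?invariant_gt0.
  rewrite -(pair_big xpredT xpredT
    (fun p y => mu (p, y) * tree_kernel (reversal M rho) (p, y) (p', x))) /=.
  rewrite exchange_big mulr_sumr; apply: ler_sum => y _.
  rewrite !mulr_sumr; apply: ler_sum => p _.
  rewrite /mu /tree_kernel /reversal /= le_eqVlt; apply/orP; left; apply/eqP.
  have key (a c l m b : R) :
      c != 0 -> c * l * (a * m / c * b) = a * (m * (b * l)).
    by move=> c0; field.
  by apply: key; rewrite gt_eqF ?invariant_gt0.
exists C => p r tp edge.
have := propC (p, r); rewrite /mu /tree_weight /= tp => h.
rewrite mulrAC -h.
  by rewrite mulrAC divff ?mul1r // gt_eqF ?invariant_gt0.
by apply: prodr_gt0 => v nvr; rewrite reversal_gt0 edge.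
Qed.

End Proportionality.

(** * Spanning trees of the graph and their parent functions *)

Section ParentArcs.
Variable V : finType.
Implicit Types (p q : {ffun V -> V}) (r v x y : V) (t : {set {set V}}).

Definition parent_arcs p r : {set V * V} :=
  [set a | (a.1 != r) && (a.2 == p a.1)]%SET.

Lemma parent_arcs_inj p q r : p r = r -> q r = r ->
  parent_arcs p r = parent_arcs q r -> p = q.
Proof.
move=> pr qr /finset.setP eq; apply/ffunP => v.
have [->|nvr] := eqVneq v r; first by rewrite pr qr.
by have := eq (v, p v); rewrite !inE /= nvr eqxx => /esym/eqP.
Qed.

Lemma prod_parent_arcs (R : comNzRingType) (F : V -> V -> R) p r :
  \prod_(a in parent_arcs p r) F a.1 a.2 = \prod_(v | v != r) F v (p v).
Proof.
under eq_bigl do rewrite inE.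
rewrite -(pair_big_dep (fun v => v != r) (fun v y => y == p v) F) /=.
by apply: eq_bigr => v _; rewrite big_pred1_eq.
Qed.

Lemma adjC t x y : adj t x y = adj t y x.
Proof. by rewrite /adj finset.setUC. Qed.

(** If two simple paths from x to r start with different vertices y1 and y2, then
   y1 and y2 are connected in t deprived of x, and adding x to a simple path
   between them gives a cycle. *)
Lemma acyclic_parent_uniq t r x y1 y2 :
  acyclic t -> is_parent t r x y1 -> is_parent t r x y2 -> y1 = y2.
Proof.
move=> [loopless acyc] [s1 [p1 u1 l1]] [s2 [p2 u2 l2]].
apply: contrapT => /eqP neq.
pose e := [rel a b | [&& adj t a b, a != x & b != x]].
have e_sym : symmetric e by move=> a b /=; rewrite adjC [_ && (b != x)]andbC.
have avoid y s : path (adj t) x (y :: s) -> uniq (x :: y :: s) ->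
    connect e y (last y s).
  move=> /= /andP[_ pth] /andP[xs _]; apply/connectP; exists s => //.
  apply: (sub_in_path (P := predC1 x) (e := adj t)) pth.
    by move=> a b /= ax bx ab; apply/and3P.
  by apply/allP => a ais; rewrite /=; apply: contraNneq xs => <-.
have /connectP[m em lm] : connect e y1 y2.
  apply: connect_trans (avoid _ _ p1 u1) _.
  by rewrite (sym_connect_sym e_sym) l1 -l2; apply: avoid.
case/shortenP: em lm => m' em um _ lm.
have x_notin : x \notin y1 :: m'.
  rewrite inE negb_or; apply/andP; split.
    by move: u1; rewrite /= inE negb_or => /andP[/andP[]].
  elim: (m') (y1) em => //= a s IH b /andP[/and3P[_ _ ax] /IH].
  by rewrite inE negb_or eq_sym ax.
apply: (acyc (x :: y1 :: m')).
  by case: (m') lm => //= e12; rewrite e12 eqxx in neq.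
rewrite /ucycle /ucycleb; apply/andP; split; last by rewrite /= x_notin.
move: p1 p2 => /= /andP[xy1 _] /andP[xy2 _].
rewrite xy1 rcons_path -lm adjC xy2 andbT /=.
by apply: sub_path em => a b /and3P[].
Qed.

Lemma is_parent_root t r y : ~ is_parent t r r y.
Proof. by case=> s [_ /= /andP[rs _] lst]; rewrite -lst mem_last in rs. Qed.

(** The parent of v is the second vertex of a simple path from v to r, and the
   rest of this path is a simple path from the parent to r: hence following
   parents leads to r. *)
Lemma spanning_tree_parent t r : graph_connected t -> acyclic t ->
  exists p : {ffun V -> V}, [/\ ptree p r,
    forall v, v != r -> [set v; p v]%SET \in t & arcs t r = parent_arcs p r].
Proof.
move=> conn acyc.
have parent v : exists y, if v == r then y = r else is_parent t r v y.
  have [_|nvr] := eqVneq v r; first by exists r.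
  have /connectP[s] := conn v r; case/shortenP=> -[|y s'] pth us _ /= lst.
    by rewrite lst eqxx in nvr.
  by exists y, s'.
have [f fP] := choice parent; pose p : {ffun V -> V} := [ffun v => f v].
have pr : p r = r by have := fP r; rewrite eqxx ffunE.
have pP v : v != r -> is_parent t r v (p v).
  by move=> nvr; have := fP v; rewrite (negbTE nvr) ffunE.
have climb s v : path (adj t) v s -> uniq (v :: s) -> last v s = r ->
    exists k, iter k p v = r.
  elim: s v => [|y s IH] v pth us lst; first by exists 0%N.
  have vy : is_parent t r v y by exists s.
  have [k it] : exists k, iter k p y = r.
    by move: pth us => /= /andP[_ pth] /andP[_ us]; apply: IH.
  exists k.+1; rewrite iterSr (@acyclic_parent_uniq t r v (p v) y) //.
  by apply: pP; apply/eqP => vr; rewrite vr in vy; apply: is_parent_root vy.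
exists p; split.
- apply/ptreeP; split=> // v; have [->|/pP] := eqVneq v r; first by exists 0%N.
  by case=> s [pth us lst]; apply: (climb (p v :: s)).
- by move=> v /pP[s [/= /andP[]]].
- apply/finset.setP => -[v y]; rewrite !inE /=; apply/asboolP/andP.
    move=> vy; have nvr : v != r.
      by apply/eqP => vr; rewrite vr in vy; apply: is_parent_root vy.
    by split=> //; apply/eqP; apply: acyclic_parent_uniq acyc vy (pP v nvr).
  by case=> nvr /eqP ->; apply: pP.
Qed.

End ParentArcs.

(** * First entrance trees of infinite sequences *)

Section FirstEntranceTree.
Variable V : finType.
Implicit Types (w : nat -> V) (p : {ffun V -> V}) (r v : V) (i j k n : nat).

Lemma tauP w k j : tau w k = Some j <->
  #|visited w j| = k /\ forall i, #|visited w i| = k -> (j <= i)%N.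
Proof.
rewrite /tau; case: pselect => [h|nh]; last first.
  by split=> // -[wj _]; case: nh; exists j; apply/eqP.
case: ex_minnP => m /eqP wm minm; split=> [[<-]|[wj minj]].
  by split=> // i /eqP; apply: minm.
by congr Some; apply/eqP; rewrite eqn_leq minj // minm //; apply/eqP.
Qed.

Lemma visitedP w j v : reflect (exists2 i, (i <= j)%N & w i = v)
  (v \in visited w j).
Proof.
apply: (iffP finset.imsetP) => [[i _ ->]|[i ij <-]].
  by exists i => //; rewrite -ltnS.
by exists (Ordinal (ij : (i < j.+1)%N)).
Qed.

Lemma subset_visited w i j : (i <= j)%N -> visited w i \subset visited w j.
Proof.
move=> ij; apply/fintype.subsetP => v /visitedP[k ki <-].
by apply/visitedP; exists k => //; apply: leq_trans ij.
Qed.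

(** The walk after time 0, so that w 0 :: future w n lists the first n + 1
   vertices. *)
Definition future w n : seq V := [seq w i | i <- iota 1 n].

Lemma futureS w n : future w n.+1 = rcons (future w n) (w n.+1).
Proof. by rewrite /future -[n.+1]addn1 iotaD map_cat cats1 /= add1n addn1. Qed.

Lemma prefixE w n : w 0%N :: future w n = [seq w i | i <- iota 0 n.+1].
Proof. by []. Qed.

Lemma nth_prefix w n x0 i : (i <= n)%N -> nth x0 (w 0%N :: future w n) i = w i.
Proof.
by move=> le_in; rewrite prefixE (nth_map 0%N) ?size_iota ?nth_iota.
Qed.

Lemma mem_prefix w n v : (v \in w 0%N :: future w n) = (v \in visited w n).
Proof.
rewrite prefixE; apply/mapP/visitedP => [[i]|[i le_in <-]].
  by rewrite mem_iota => /andP[_ lt] ->; exists i.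
by exists i => //; rewrite mem_iota.
Qed.

Lemma index_first_visit w n j : (j <= n)%N ->
  (forall i, (i < j)%N -> w i != w j) ->
  index (w j) (w 0%N :: future w n) = j.
Proof.
move=> jn first_visit; set s := _ :: _.
have wj : w j \in s by rewrite mem_prefix; apply/visitedP; exists j.
have lt : (index (w j) s < n.+1)%N.
  by rewrite -index_mem /= size_map size_iota in wj.
have := nth_index (w 0%N) wj; rewrite nth_prefix // => eq.
apply/eqP; rewrite eqn_leq; apply/andP; split; rewrite leqNgt; apply/negP.
  move=> /(before_find (w 0%N)) /=.
  by rewrite nth_prefix // eqxx.
by move=> /first_visit; rewrite eq eqxx.
Qed.

(** The times tau w k with k > 1 are exactly the positive times j at which w j is
   visited for the first time, k being then the number of vertices visited up to
   time j; and a covering prefix contains all the first visits. *)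
Lemma FET_prefix w n : covers (w 0%N) (future w n) ->
  FET w = (parent_arcs (entrance (w 0%N) (future w n)) (w 0%N), w 0%N).
Proof.
move=> /forallP cov; congr pair; apply/finset.setP => -[v y]; rewrite !inE /=.
rewrite ffunE; apply/existsP/andP.
  (* A time tau w k at which a new vertex is met is its index in the prefix. *)
  move=> [k /andP[k_gt1]]; case ek: (tau w k) => [j|] // /eqP[-> ->].
  have [card_j min_j] := (tauP w k j).1 ek.
  have j_gt0 : (0 < j)%N.
    rewrite lt0n; apply: contraTneq k_gt1 => j0.
    rewrite -leqNgt -card_j j0 (leq_trans (leq_imset_card _ _)) //.
    by rewrite card_ord.
  have new i : (i < j)%N -> w i != w j.
    move=> ij; apply/eqP => wij.
    have /min_j : #|visited w j.-1| = k; last by rewrite leqNgt prednK ?leqnn.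
    rewrite -card_j; apply/eqP; rewrite eqn_leq subset_leq_card /=; last first.
      by apply: subset_visited; apply: leq_pred.
    apply/subset_leq_card/fintype.subsetP => u /visitedP[l lj <-].
    apply/visitedP; move: lj; rewrite leq_eqVlt => /orP[/eqP ->|lj].
      by exists i => //; lia.
    by exists l => //; lia.
  have jn : (j <= n)%N.
    have := cov (w j); rewrite mem_prefix => /visitedP[i le_in wij].
    rewrite leqNgt; apply/negP => nj; have := new i (leq_ltn_trans le_in nj).
    by rewrite wij eqxx.
  rewrite index_first_visit // nth_prefix; last by lia.
  by rewrite eq_sym new.
(* Conversely, take for k the number of vertices visited up to the index of v. *)
move=> [nv0 /eqP ->].
have := cov v; rewrite -index_mem; set j := index v _ => lt_j.
have wj : w j = v.
  have := nth_index (w 0%N) (cov v); rewrite nth_prefix // -ltnS.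
  by move: lt_j; rewrite /= size_map size_iota.
have jn : (j <= n)%N by move: lt_j; rewrite /= size_map size_iota.
have new i : (i < j)%N -> w i != v.
  move=> ij; have := before_find (w 0%N) ij; rewrite nth_prefix /=; last by lia.
  by move=> ->.
have card_j i : (i < j)%N -> (#|visited w i| < #|visited w j|)%N.
  move=> ij; apply: proper_card; apply/properP; split.
    by apply: subset_visited; apply: ltnW.
  exists v; first by apply/visitedP; exists j.
  apply/visitedP => -[l li wl]; have := new l (leq_ltn_trans li ij).
  by rewrite wl eqxx.
have j_gt0 : (0 < j)%N by rewrite lt0n; apply: contraNneq nv0 => <-; rewrite wj.
have card_gt1 : (1 < #|visited w j|)%N.
  apply: leq_ltn_trans (card_j 0%N j_gt0).
  by apply/card_gt0P; exists (w 0%N); apply/visitedP; exists 0%N.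
have ltV : (#|visited w j| < #|V|.+1)%N by rewrite ltnS max_card.
exists (Ordinal ltV); rewrite /= card_gt1 /=.
have -> : tau w #|visited w j| = Some j.
  apply/tauP; split=> // i ci; rewrite leqNgt; apply/negP => /card_j.
  by rewrite ci ltnn.
by rewrite wj nth_prefix //; lia.
Qed.

Lemma cover_time_finite w :
  tau w #|V| <> None <-> exists n, covers (w 0%N) (future w n).
Proof.
split=> [|[n /forallP cov]].
  case ew: (tau w #|V|) => [j|] // _; exists j.
  have [card_j _] := (tauP _ _ _).1 ew.
  apply/forallP => v; rewrite mem_prefix.
  suff -> : visited w j = finset.setT by rewrite inE.
  by apply/eqP; rewrite eqEcard finset.subsetT cardsT card_j /=.
rewrite /tau; case: pselect => // -[]; exists n.
rewrite (_ : visited w n = finset.setT) ?cardsT //.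
by apply/finset.setP => v; rewrite -mem_prefix cov inE.
Qed.

Lemma FET_parent_arcs w p r : p r = r ->
  (tau w #|V| <> None /\ FET w = (parent_arcs p r, r)) <->
  (w 0%N = r /\ exists n, covers_with p r (future w n)).
Proof.
move=> pr; rewrite cover_time_finite; split.
  move=> [[n cov]]; rewrite (FET_prefix cov) => -[earcs w0]; split=> //.
  exists n; move: cov earcs; rewrite w0 => cov earcs.
  apply/andP; split=> //; apply/eqP; apply: parent_arcs_inj pr earcs.
  by rewrite ffunE /= eqxx.
move=> [w0 [n /andP[cov /eqP ep]]]; rewrite -w0 in cov ep.
by split; [exists n|rewrite (FET_prefix cov) ep w0].
Qed.

End FirstEntranceTree.

(** * From the chain to path sums *)

Local Open Scope classical_set_scope.

Section ChainLaw.
Variables (R : realType) (V : finType) (M : V -> V -> R).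
Variables (d : measure_display) (Omega : measurableType d).
Variables (P : probability Omega R) (W : nat -> Omega -> V).
Hypothesis chainW : markov_chain P M W.
Implicit Types (x : nat -> V) (n m : nat) (B : pred (seq V)).

Definition past_event x n : set Omega :=
  [set omega | forall i, (i <= n)%N -> W i omega = x i].

Lemma past_event0 x : past_event x 0 = [set omega | W 0%N omega = x 0%N].
Proof.
apply/seteqP; split=> omega /= h; first exact: h.
by move=> i; rewrite leqn0 => /eqP ->.
Qed.

Lemma past_eventS x n : past_event x n.+1 =
  [set omega | W n.+1 omega = x n.+1] `&` past_event x n.
Proof.
apply/seteqP; split=> omega /=.
  by move=> h; split=> [|i le_in]; apply: h => //; apply: ltnW.
by move=> [h1 h2] i; rewrite leq_eqVlt => /orP[/eqP ->//|/h2].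
Qed.

Lemma measurable_past x n : measurable (past_event x n).
Proof.
have [mW _] := chainW; elim: n => [|n IH]; first by rewrite past_event0.
by rewrite past_eventS; apply: measurableI.
Qed.

Lemma prob_fineK (A : set Omega) : measurable A -> (fine (P A))%:E = P A.
Proof. by move=> mA; rewrite fineK // fin_num_measure. Qed.

(** Both sides vanish when the past has probability 0, where conditional
   probabilities say nothing. *)
Lemma prob_past_eventS x n :
  fine (P (past_event x n.+1)) = fine (P (past_event x n)) * M (x n) (x n.+1).
Proof.
have [mW trans] := chainW.
have [pos|] := ltP 0%E (P (past_event x n)).
  rewrite -(trans n x (x n.+1) pos) /cprob -/(past_event x n) -past_eventS.
  rewrite mulrC divfK // gt_eqF // -lte_fin prob_fineK //.
  exact: measurable_past.
move=> npos; have null : P (past_event x n) = 0%E.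
  by apply: le_anti; rewrite npos measure_ge0.
have nullS : P (past_event x n.+1) = 0%E.
  apply: le_anti; rewrite measure_ge0 andbT -null le_measure ?inE //.
  - exact: measurable_past.
  - exact: measurable_past.
  - by rewrite past_eventS; apply: subIsetr.
by rewrite null nullS /= mul0r.
Qed.

Definition path_event x n m B : set Omega :=
  past_event x n `&` [set omega | B [seq W i omega | i <- iota n.+1 m]].

Definition extend x n z : nat -> V := fun i => if (i <= n)%N then x i else z.

Lemma path_eventS x n m B : path_event x n m.+1 B =
  \bigcup_(z in [set` index_enum V])
    path_event (extend x n z) n.+1 m (fun s => B (z :: s)).
Proof.
apply/seteqP; split=> omega.
  move=> [past Bw]; exists (W n.+1 omega); first by rewrite /= mem_index_enum.
  split=> // i; rewrite /extend leq_eqVlt.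
  case: (leqP i n) => [le_in _|lt_ni]; first exact: past.
  by rewrite ltnS leqNgt lt_ni orbF => /eqP ->.
move=> [z _ [past Bw]].
have Wz : W n.+1 omega = z by rewrite past // /extend ltnn.
split; last by move: Bw; rewrite /= Wz.
by move=> i le_in; rewrite past ?leqW // /extend le_in.
Qed.

(** Induction on the number of future steps, splitting the event according to the
   next vertex. *)
Lemma path_event_law m n x B : measurable (path_event x n m B) /\
  fine (P (path_event x n m B)) =
    fine (P (past_event x n)) * path_sum M m (x n) (fun s => (B s)%:R).
Proof.
elim: m n x B => [|m IH] n x B.
  rewrite /path_event /=; case: (B [::]).
    have -> : [set omega : Omega | true] = setT by apply/seteqP; split.
    by rewrite setIT mulr1; split=> //; apply: measurable_past.
  have -> : [set omega : Omega | false] = set0 by apply/seteqP; split.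
  by rewrite setI0 measure0 mulr0.
have mext z :
    measurable (path_event (extend x n z) n.+1 m (fun s => B (z :: s))).
  by case: (IH n.+1 (extend x n z) (fun s => B (z :: s))).
rewrite path_eventS; split.
  by apply: fin_bigcup_measurable => // *; apply: finite_seq.
rewrite measure_fin_bigcup //; last first.
  move=> z1 z2 _ _ [omega [[past1 _] [past2 _]]].
  have := past1 n.+1 (leqnn _); rewrite past2 // /extend ltnn.
  by [].
rewrite -fsbig_seq ?index_enum_uniq //=.
rewrite -sum_fine => [|z _]; last exact: fin_num_measure.
rewrite mulr_sumr; apply: eq_bigr => z _.
have [_ ->] := IH n.+1 (extend x n z) (fun s => B (z :: s)).
rewrite prob_past_eventS /extend leqnn ltnn -mulrA; congr (fine (P _) * _).
by apply/seteqP; split=> omega past i le_in; rewrite past //= le_in.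
Qed.

(** The event is the increasing union over n of the events that V is covered by
   time n with the right first entrances. *)
Lemma cprob_FET_event (p : {ffun V -> V}) r : markov_kernel M ->
  p r = r -> (0 < P [set omega | W 0%N omega = r])%E ->
  cprob P (FET_event W (parent_arcs p r, r)) [set omega | W 0%N omega = r] =
  entrance_law M p r.
Proof.
move=> M_kernel pr P0; set S := [set omega | _] in P0 *.
have [mW _] := chainW; have mS : measurable S by apply: mW.
pose F n := path_event (fun=> r) 0 n (covers_with p r).
have pastE : past_event (fun=> r) 0 = S by rewrite past_event0.
have FE : FET_event W (parent_arcs p r, r) `&` S = \bigcup_n F n.
  apply/seteqP; split=> omega.
    move=> [/(FET_parent_arcs _ pr)[_ [n cov]] Sw].
    by exists n => //; split=> //; rewrite pastE.
  move=> [n _ [+ cov]]; rewrite pastE => Sw; split=> //.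
  by apply/FET_parent_arcs => //; split=> //; exists n.
have mF n : measurable (F n).
  by case: (path_event_law n 0 (fun=> r) (covers_with p r)).
have ndF : nondecreasing_seq F.
  apply/nondecreasing_seqP => n; apply/subsetPset => omega [past cov].
  split=> //; suff : covers_with p r (future (W^~ omega) n.+1) by [].
  by rewrite futureS; apply: covers_with_rcons.
have cvgF : P (F n) @[n --> \oo] --> P (\bigcup_n F n).
  by apply: nondecreasing_cvg_mu => //; apply: bigcup_measurable.
have mU : measurable (\bigcup_n F n) by apply: bigcup_measurable.
have S_neq0 : fine (P S) != 0 by rewrite gt_eqF // -lte_fin prob_fineK.
have cvg_law : fine (P (F n)) @[n --> \oo] --> fine (P S) * entrance_law M p r.
  rewrite (_ : (fun n => _) = (fun n => fine (P S) * entrance_prob M p r n)).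
    by apply: cvgMl_tmp; apply: entrance_prob_cvg.
  apply/funext => n; rewrite -pastE.
  by have [_ ->] := path_event_law n 0 (fun=> r) (covers_with p r).
rewrite -(prob_fineK mU) in cvgF.
rewrite /cprob FE -(cvg_lim _ (fine_cvg cvgF)) // (cvg_lim _ cvg_law) //.
by rewrite mulrAC divff // mul1r.
Qed.

End ChainLaw.

Theorem theorem3 (R : realType) (V : finType) (E : {set {set V}})
    (M : V -> V -> R) (rho : V -> R)
    (graphE : is_graph E) (connE : graph_connected E)
    (kernelM : markov_kernel M) (posM : positive_on E M)
    (invrho : invariant_distribution M rho) :
  exists C : R,
    forall (d : measure_display) (Omega : measurableType d)
      (P : probability Omega R) (W : nat -> Omega -> V),
    markov_chain P M W ->
    forall (t : {set {set V}}) (r : V),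
    spanning_tree E t ->
    (0 < P [set omega | W 0%N omega = r])%E ->
    cprob P (FET_event W (rooted_tree t r)) [set omega | W 0%N omega = r] =
    C / rho r * \prod_(a in arcs t r) reversal M rho a.1 a.2.
Proof.
have [C lawE] := entrance_law_proportional connE kernelM posM invrho.
exists C => d Omega P W chainW t r [tE conn_t acyc_t] P0.
have [p [tp p_edge arcsE]] := spanning_tree_parent r conn_t acyc_t.
have [pr _] := ptreeP _ _ tp.
rewrite /rooted_tree arcsE (cprob_FET_event chainW) // lawE //.
  by rewrite prod_parent_arcs.
by move=> v nvr; apply: (fintype.subsetP tE); apply: p_edge.
Qed.
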